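(* The functors $\alpha:\mathbf{sHF}\to\mathbf{sN}$ and $\beta:\mathbf{sN}\to\mathbf{sHF}$ establish an equivalence between the categories $\mathbf{sHF}$ and $\mathbf{sN}$; that is, $\beta\alpha$ is naturally isomorphic to the identity functor of $\mathbf{sHF}$ and $\alpha\beta$ is naturally isomorphic to the identity functor of $\mathbf{sN}$.
   Context: **Semi-Heyting algebra**: an algebra $\mathbf{H}=\langle H;\land,\lor,\Rightarrow,0,1\rangle$ of type $(2,2,2,0,0)$ such that $\langle H,\land,\lor,0,1\rangle$ is a bounded lattice and for all $x,y,z\in H$: $x\land(x\Rightarrow y)=x\land y$; $x\land(y\Rightarrow z)=x\land((x\land y)\Rightarrow(x\land z))$; $x\Rightarrow x=1$. Write $x^*=x\Rightarrow 0$ (this is the pseudocomplement of $x$). An element $x$ is dense if $x^*=0$; $\mathcal{D}_s(H)$ is the set of dense elements of $H$. **Semi-Nelson algebra**: an algebra $\mathbf{A}=\langle A;\land,\lor,\to,\sim,1\rangle$ of type $(2,2,2,1,0)$ such that, writing $x\to_N y:=x\to(x\land y)$, for all $x,y,z\in A$: (SN1) $x\land(x\lor y)=x$; (SN2) $x\land(y\lor z)=(z\land x)\lor(y\land x)$; (SN3) $\sim\sim x=x$; (SN4) $\sim(x\land y)=\sim x\lor\sim y$; (SN5) $x\land\sim x=(x\land\sim x)\land(y\lor\sim y)$; (SN6) $x\land(x\to_N y)=x\land(\sim x\lor y)$; (SN7) $x\to_N(y\to_N z)=(x\land y)\to_N z$; (SN8) $(x\to_N y)\to_N[(y\to_N x)\to_N[(x\to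 z)\to_N(y\to z)]]=1$; (SN9) $(x\to_N y)\to_N[(y\to_N x)\to_N[(z\to x)\to_N(z\to y)]]=1$; (SN10) $(\sim(x\to y))\to_N(x\land\sim y)=1$; (SN11) $(x\land\sim y)\to_N(\sim(x\to y))=1$. **$i$-filter**: a subset $F\subseteq H$ of a semi-Heyting algebra $\mathbf{H}$ such that (IF1) $F$ is a lattice filter of $\mathbf{H}$; (IF2) $\mathcal{D}_s(H)\subseteq F$; (IF3) whenever $z,t\in H$ and $z\lor t\in F$, then for all $x\in H$, $(x\Rightarrow z)\lor(x\land t)\in F$. **The algebra $\mathbf{N(H,F)}$**: for a semi-Heyting algebra $\mathbf{H}$ and an $i$-filter $F$, $N(H,F)=\{(a,b)\in H^2: a\land b=0,\ a\lor b\in F\}$, and $\mathbf{N(H,F)}=\langle N(H,F);\sqcap,\sqcup,\to,\sim,\top\rangle$ with $(a,b)\sqcap(c,d)=(a\land c,b\lor d)$, $(a,b)\sqcup(c,d)=(a\lor c,b\land d)$, $(a,b)\to(c,d)=(a\Rightarrow c,a\land d)$, $\sim(a,b)=(b,a)$, $\top=(1,0)$. It is a semi-Nelson algebra. **Quotient $\mathbf{sH}(\mathbf{A})$**: for a semi-Nelson algebra $\mathbf{A}$, put $x\equiv y$ iff $x\to y=1$ and $y\to x=1$. This is an equivalence relation compatible with $\land,\lor,\to$; $[\![x]\!]$ denotes the class of $x$. $\mathbf{sH}(\mathbf{A})=\langle A/_\equiv,\cap,\cup,\Rightarrow,\bot,\top\rangle$ with $\bot=[\![\sim 1]\!]$,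 $\top=[\![1]\!]$, $[\![x]\!]\cap[\![y]\!]=[\![x\land y]\!]$, $[\![x]\!]\cup[\![y]\!]=[\![x\lor y]\!]$, $[\![x]\!]\Rightarrow[\![y]\!]=[\![x\to y]\!]$; it is a semi-Heyting algebra. **Positive elements**: $A^+=\{a\in A:\ \sim a\le a\}$ for a semi-Nelson algebra $\mathbf{A}$, and $[\![A^+]\!]=\{[\![a]\!]:a\in A^+\}$, which is an $i$-filter of $\mathbf{sH}(\mathbf{A})$. **Categories**: $\mathbf{sHF}$ has as objects the pairs $(\mathbf{H},F)$ with $\mathbf{H}$ a semi-Heyting algebra and $F$ an $i$-filter of $\mathbf{H}$; a morphism $f:(\mathbf{H},F)\to(\mathbf{H}',F')$ is a homomorphism of semi-Heyting algebras $f:H\to H'$ with $f(F)\subseteq F'$. $\mathbf{sN}$ is the category of semi-Nelson algebras and their homomorphisms. **Functors**: $\alpha(\mathbf{H},F)=\mathbf{N(H,F)}$ and $\alpha(f)(a,b)=(f(a),f(b))$; $\beta(\mathbf{A})=(\mathbf{sH}(\mathbf{A}),[\![A^+]\!])$ and $\beta(f)([\![a]\!])=[\![f(a)]\!]$. *)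

(* Defs.v *)
From HB Require Import structures.
From mathcomp Require Import all_boot all_order.
From mathcomp Require Import boolp classical_sets.

Set Implicit Arguments.
Unset Strict Implicit.
Unset Printing Implicit Defensive.

Import Order.TTheory.
Local Open Scope order_scope.
Local Open Scope quotient_scope.

Reserved Notation "x =h> y" (at level 55, right associativity).
Reserved Notation "x /s\ y" (at level 48, left associativity).
Reserved Notation "x \s/ y" (at level 50, left associativity).
Reserved Notation "x -s> y" (at level 55, right associativity).
Reserved Notation "x -N> y" (at level 55, right associativity).
Reserved Notation "~s x" (at level 35, right associativity).

Record category := Category {
  obj :> Type;
  hom : obj -> obj -> Type;
  idc : forall x, hom x x;
  compc : forall x y z, hom y z -> hom x y -> hom x z;
  compc1 : forall x y (f : hom x y), compc f (idc x) = f;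
  comp1c : forall x y (f : hom x y), compc (idc y) f = f;
  compcA : forall x y z t (h : hom z t) (g : hom y z) (f : hom x y),
    compc h (compc g f) = compc (compc h g) f }.

Arguments idc {c} x.
Arguments compc {c x y z}.

Record functor (C D : category) := Functor {
  fobj :> C -> D;
  fmap : forall x y, hom x y -> hom (fobj x) (fobj y);
  fmap1 : forall x, fmap (idc x) = idc (fobj x);
  fmapM : forall x y z (g : hom y z) (f : hom x y),
    fmap (compc g f) = compc (fmap g) (fmap f) }.

Arguments fmap {C D} f {x y} : rename.

Program Definition functor_id (C : category) : functor C C :=
  @Functor C C id (fun _ _ f => f) _ _.

Program Definition functor_comp (C D E : category)
    (G : functor D E) (F : functor C D) : functor C E :=
  @Functor C E (fun x => G (F x)) (fun _ _ f => fmap G (fmap F f)) _ _.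
Next Obligation. by rewrite !fmap1. Qed.
Next Obligation. by rewrite !fmapM. Qed.

Definition is_iso (C : category) (x y : C) (f : hom x y) :=
  exists g : hom y x, compc g f = idc x /\ compc f g = idc y.

Record nat_trans (C D : category) (F G : functor C D) := NatTrans {
  ntcomp :> forall x, hom (F x) (G x);
  naturality : forall x y (f : hom x y),
    compc (ntcomp y) (fmap F f) = compc (fmap G f) (ntcomp x) }.

Definition naturally_isomorphic (C D : category) (F G : functor C D) :=
  exists eta : nat_trans F G, forall x, is_iso (eta x).

(* As everywhere in MathComp, the carriers of algebras are choiceTypes; this is
   no restriction, since classically every type has such a structure
   ([gen_eqMixin] and [gen_choiceMixin] in boolp). *)
HB.mixin Record isSemiHeyting d T of Order.TBLattice d T := {
  shimp : T -> T -> T;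
  meet_shimp : forall x y : T, x `&` shimp x y = x `&` y;
  meet_shimp_meet : forall x y z : T,
    x `&` shimp y z = x `&` shimp (x `&` y) (x `&` z);
  shimpxx : forall x : T, shimp x x = \top }.

#[short(type="semiHeytingType")]
HB.structure Definition SemiHeyting d :=
  { T of isSemiHeyting d T & Order.TBLattice d T }.

Notation "x =h> y" := (shimp x y) : order_scope.

Section SemiHeytingDefs.
Context {d : Order.disp_t} {H : semiHeytingType d}.
Implicit Types (x y z t : H) (F : set H).

Definition shneg x := x =h> \bot.

Definition dense_elements : set H := [set x | shneg x = \bot]%classic.

Record lattice_filter F : Prop := LatticeFilter {
  filter1 : F \top;
  filter_up : forall x y, F x -> x <= y -> F y;
  filterI : forall x y, F x -> F y -> F (x `&` y) }.

Record ifilter F : Prop := IFilter {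
  IF1 : lattice_filter F;
  IF2 : (dense_elements `<=` F)%classic;
  IF3 : forall z t, F (z `|` t) -> forall x, F ((x =h> z) `|` (x `&` t)) }.

End SemiHeytingDefs.

Record semiHeyting_hom d (H H' : semiHeytingType d) (f : H -> H') : Prop := {
  sh_meet : forall x y, f (x `&` y) = f x `&` f y;
  sh_join : forall x y, f (x `|` y) = f x `|` f y;
  sh_imp : forall x y, f (x =h> y) = f x =h> f y;
  sh_bot : f \bot = \bot;
  sh_top : f \top = \top }.

Section SemiNelsonAxioms.
Variables (T : Type) (meet join imp : T -> T -> T) (neg : T -> T) (one : T).
Local Notation "x /s\ y" := (meet x y).
Local Notation "x \s/ y" := (join x y).
Local Notation "x -s> y" := (imp x y).
Local Notation "x -N> y" := (x -s> (x /s\ y)).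
Local Notation "~s x" := (neg x).

Record semiNelson_axioms : Prop := SemiNelsonAxioms {
  SN1_ : forall x y, x /s\ (x \s/ y) = x;
  SN2_ : forall x y z, x /s\ (y \s/ z) = (z /s\ x) \s/ (y /s\ x);
  SN3_ : forall x, ~s ~s x = x;
  SN4_ : forall x y, ~s (x /s\ y) = ~s x \s/ ~s y;
  SN5_ : forall x y, x /s\ ~s x = (x /s\ ~s x) /s\ (y \s/ ~s y);
  SN6_ : forall x y, x /s\ (x -N> y) = x /s\ (~s x \s/ y);
  SN7_ : forall x y z, (x -N> (y -N> z)) = ((x /s\ y) -N> z);
  SN8_ : forall x y z,
    (x -N> y) -N> ((y -N> x) -N> ((x -s> z) -N> (y -s> z))) = one;
  SN9_ : forall x y z,
    (x -N> y) -N> ((y -N> x) -N> ((z -s> x) -N> (z -s> y))) = one;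
  SN10_ : forall x y, (~s (x -s> y)) -N> (x /s\ ~s y) = one;
  SN11_ : forall x y, (x /s\ ~s y) -N> (~s (x -s> y)) = one }.
End SemiNelsonAxioms.

HB.mixin Record isSemiNelson T of Choice T := {
  snmeet : T -> T -> T;
  snjoin : T -> T -> T;
  snimp : T -> T -> T;
  snneg : T -> T;
  snone : T;
  snP : semiNelson_axioms snmeet snjoin snimp snneg snone }.

#[short(type="semiNelsonType")]
HB.structure Definition SemiNelson := { T of isSemiNelson T & Choice T }.

Declare Scope semiNelson_scope.
Delimit Scope semiNelson_scope with SN.
Notation "x /s\ y" := (snmeet x y) : semiNelson_scope.
Notation "x \s/ y" := (snjoin x y) : semiNelson_scope.
Notation "x -s> y" := (snimp x y) : semiNelson_scope.
Notation "~s x" := (snneg x) : semiNelson_scope.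
Notation "x -N> y" := (snimp x (snmeet x y)) : semiNelson_scope.
Notation "1" := snone : semiNelson_scope.
Local Open Scope semiNelson_scope.

Record semiNelson_hom (A B : semiNelsonType) (f : A -> B) : Prop := {
  sn_meet : forall x y, f (x /s\ y) = f x /s\ f y;
  sn_join : forall x y, f (x \s/ y) = f x \s/ f y;
  sn_imp : forall x y, f (x -s> y) = f x -s> f y;
  sn_neg : forall x, f (~s x) = ~s f x;
  sn_one : f 1 = 1 }.

(* The order of the lattice reduct. *)
Definition snle (A : semiNelsonType) (x y : A) := x /s\ y = x.

Definition positive (A : semiNelsonType) : set A := [set a | snle (~s a) a]%classic.

(* The display of the order structures plays no mathematical role. *)
Notation shType := (semiHeytingType (Order.Disp tt tt)).

Record sHF_obj := SHFObj {
  sHF_alg :> shType;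
  sHF_filter : set sHF_alg;
  sHF_ifilter : ifilter sHF_filter }.

Arguments sHF_filter : clear implicits.

Record sHF_hom (X Y : sHF_obj) := SHFHom {
  sHF_fun :> X -> Y;
  sHF_homP : semiHeyting_hom sHF_fun;
  sHF_sub : (sHF_fun @` sHF_filter X `<=` sHF_filter Y)%classic }.

Lemma sHF_hom_eq (X Y : sHF_obj) (f g : sHF_hom X Y) : f =1 g -> f = g.
Proof.
case: f => f f1 f2; case: g => g g1 g2 /= /funext fg.
by case: g / fg g1 g2 => g1 g2; congr SHFHom; apply: Prop_irrelevance.
Qed.

Lemma sHF_id_hom (X : sHF_obj) : semiHeyting_hom (@id X).
Proof. by []. Qed.

Definition sHF_id (X : sHF_obj) : sHF_hom X X.
Proof.
by exists id; [exact: sHF_id_hom | move=> _ [x Fx <-]].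
Defined.

Lemma sHF_comp_hom (X Y Z : sHF_obj) (g : sHF_hom Y Z) (f : sHF_hom X Y) :
  semiHeyting_hom (g \o f).
Proof.
case: g => g /= [g1 g2 g3 g4 g5] _; case: f => f /= [f1 f2 f3 f4 f5] _.
by split=> [x y|x y|x y||] /=;
  rewrite ?(f1, f2, f3, f4, f5) ?(g1, g2, g3, g4, g5).
Qed.

Lemma sHF_comp_sub (X Y Z : sHF_obj) (g : sHF_hom Y Z) (f : sHF_hom X Y) :
  ((g \o f) @` sHF_filter X `<=` sHF_filter Z)%classic.
Proof.
move=> _ [x Fx <-]; apply: (sHF_sub (s := g)); exists (f x) => //.
by apply: (sHF_sub (s := f)); exists x.
Qed.

Definition sHF_comp (X Y Z : sHF_obj) (g : sHF_hom Y Z) (f : sHF_hom X Y) :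
  sHF_hom X Z := SHFHom (sHF_comp_hom g f) (@sHF_comp_sub _ _ _ g f).

Definition sHF : category.
Proof.
apply: (@Category sHF_obj sHF_hom sHF_id sHF_comp) => *;
by apply: sHF_hom_eq.
Defined.

Record sN_hom (A B : semiNelsonType) := SNHom {
  sN_fun :> A -> B;
  sN_homP : semiNelson_hom sN_fun }.

Lemma sN_hom_eq (A B : semiNelsonType) (f g : sN_hom A B) : f =1 g -> f = g.
Proof.
case: f => f f1; case: g => g g1 /= /funext fg.
by case: g / fg g1 => g1; congr SNHom; apply: Prop_irrelevance.
Qed.

Lemma sN_id_hom (A : semiNelsonType) : semiNelson_hom (@id A).
Proof. by []. Qed.

Lemma sN_comp_hom (A B C : semiNelsonType) (g : sN_hom B C) (f : sN_hom A B) :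
  semiNelson_hom (g \o f).
Proof.
case: g => g /= [g1 g2 g3 g4 g5]; case: f => f /= [f1 f2 f3 f4 f5].
by split=> [x y|x y|x y|x|] /=;
  rewrite ?(f1, f2, f3, f4, f5) ?(g1, g2, g3, g4, g5).
Qed.

Definition sN : category.
Proof.
apply: (@Category semiNelsonType sN_hom (fun A => SNHom (sN_id_hom A))
  (fun A B C g f => SNHom (sN_comp_hom g f))) => *;
by apply: sN_hom_eq.
Defined.

Section SemiHeytingTheory.
Context {d : Order.disp_t} {H : semiHeytingType d}.
Implicit Types (x y z t : H).

Lemma shimp_cong x y z t : x `&` y = x `&` z -> x `&` (t =h> y) = x `&` (t =h> z).
Proof. by move=> e; rewrite meet_shimp_meet e -meet_shimp_meet. Qed.

Lemma shimp_congl x y z t :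
  x `&` y = x `&` z -> x `&` (y =h> t) = x `&` (z =h> t).
Proof. by move=> e; rewrite meet_shimp_meet e -meet_shimp_meet. Qed.

Lemma le_shimpN z x y : (z <= x =h> (x `&` y)) = (z `&` x <= y).
Proof.
apply/idP/idP => [h|h].
  apply: (@le_trans _ _ (x `&` (x =h> (x `&` y)))).
    by rewrite meetC leI2.
  by rewrite meet_shimp meetA meetxx leIr.
rewrite leEmeet meet_shimp_meet.
have -> : z `&` (x `&` y) = z `&` x by rewrite meetA; apply/eqP; rewrite -leEmeet.
by rewrite shimpxx meetx1.
Qed.

Lemma sh_meetUl x y z : (x `|` y) `&` z = (x `&` z) `|` (y `&` z).
Proof.
apply/le_anti/andP; split; last by rewrite leUx !leI2 ?leUl ?leUr.
by rewrite -le_shimpN leUx !le_shimpN leUl leUr.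
Qed.

Lemma sh_meetUr x y z : x `&` (y `|` z) = (x `&` y) `|` (x `&` z).
Proof. by rewrite meetC sh_meetUl ![_ `&` x]meetC. Qed.

Lemma sh_joinIr x y z : x `|` (y `&` z) = (x `|` y) `&` (x `|` z).
Proof.
by rewrite sh_meetUr [_ `&` x]meetC joinKI sh_meetUl joinA meetKU.
Qed.

Lemma sh_joinIl x y z : (x `&` y) `|` z = (x `|` z) `&` (y `|` z).
Proof. by rewrite joinC sh_joinIr ![z `|` _]joinC. Qed.

Lemma shimp_curry x y z :
  x =h> (x `&` (y =h> (y `&` z))) = (x `&` y) =h> ((x `&` y) `&` z).
Proof.
apply/le_anti/andP; split.
  by rewrite le_shimpN meetA -le_shimpN -le_shimpN.
by rewrite !le_shimpN -meetA -le_shimpN.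
Qed.
End SemiHeytingTheory.

Section N.
Variable X : sHF_obj.
Implicit Types (p q : X * X).

Definition in_N : pred (X * X) :=
  fun p => (p.1 `&` p.2 == \bot) && (p.1 `|` p.2 \in sHF_filter X).

Record N := NPair { Nval : X * X; NvalP : in_N Nval }.

HB.instance Definition _ := [isSub for Nval].
HB.instance Definition _ := [Choice of N by <:].

Lemma in_NP p :
  reflect (p.1 `&` p.2 = \bot /\ sHF_filter X (p.1 `|` p.2)) (in_N p).
Proof.
by apply: (iffP andP) => -[] => [/eqP ? /set_mem|/eqP ? /mem_set].
Qed.

Definition meet_pair p q : X * X := (p.1 `&` q.1, p.2 `|` q.2).
Definition join_pair p q : X * X := (p.1 `|` q.1, p.2 `&` q.2).
Definition imp_pair p q : X * X := (p.1 =h> q.1, p.1 `&` q.2).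
Definition neg_pair p : X * X := (p.2, p.1).
Definition top_pair : X * X := (\top, \bot).

Lemma meet_pairP (u v : N) : in_N (meet_pair (Nval u) (Nval v)).
Proof.
case: u v => [[a b] /in_NP[/= ab Fab]] [[c e] /in_NP[/= ce Fce]].
have [[_ up FI] _ _] := sHF_ifilter X.
apply/in_NP; split=> /=.
  by rewrite sh_meetUr meetAC ab meet0x -meetA ce meetx0 joinxx.
apply: up (FI _ _ Fab Fce) _.
by rewrite sh_joinIl leI2 // leU2 // ?leUl ?leUr.
Qed.

Lemma neg_pairP (u : N) : in_N (neg_pair (Nval u)).
Proof.
case: u => [[a b] /in_NP[/= ab Fab]].
by apply/in_NP; rewrite /= meetC joinC.
Qed.

Lemma join_pairP (u v : N) : in_N (join_pair (Nval u) (Nval v)).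
Proof.
pose u' := NPair (neg_pairP u); pose v' := NPair (neg_pairP v).
exact: (neg_pairP (NPair (meet_pairP u' v'))).
Qed.

Lemma imp_pairP (u v : N) : in_N (imp_pair (Nval u) (Nval v)).
Proof.
case: u v => [[a b] /in_NP[/= ab Fab]] [[c e] /in_NP[/= ce Fce]].
have [_ _ imp] := sHF_ifilter X.
apply/in_NP; split=> /=; last exact: imp.
by rewrite meetA [_ `&` a]meetC meet_shimp -meetA ce meetx0.
Qed.

Lemma top_pairP : in_N top_pair.
Proof.
have [[top _ _] _ _] := sHF_ifilter X.
by apply/in_NP; rewrite /= meetx0 joinx0.
Qed.

Definition Nmeet u v := NPair (meet_pairP u v).
Definition Njoin u v := NPair (join_pairP u v).
Definition Nimp u v := NPair (imp_pairP u v).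
Definition Nneg u := NPair (neg_pairP u).
Definition Ntop := NPair top_pairP.

Lemma Nimp_eq1 (u v : N) :
  (Nval u).1 <= (Nval v).1 -> Nimp u (Nmeet u v) = Ntop.
Proof.
case: u v => [[a b] /= Nab] [[c e] /= Nce] ac; apply: val_inj => /=.
have [/= ab _] := in_NP _ Nab; have [/= ce _] := in_NP _ Nce.
rewrite /imp_pair /meet_pair /top_pair /= (meet_l ac) shimpxx.
rewrite sh_meetUr ab join0x; congr pair; apply: le_anti; rewrite le0x andbT.
by rewrite -ce leI2.
Qed.

Lemma Nimp_curry (u v w : N) :
  Nimp u (Nmeet u (Nimp v (Nmeet v w))) = Nimp (Nmeet u v) (Nmeet (Nmeet u v) w).
Proof.
apply: val_inj; case: u v w => [[a b] /= Nab] [[c e] /= Nce] [[f g] /= Nfg].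
have [/= ab _] := in_NP _ Nab; have [/= ce _] := in_NP _ Nce.
congr pair; rewrite /= ?shimp_curry // !sh_meetUr ab join0x meetA.
by rewrite -[(a `&` c) `&` e]meetA ce meetx0 [(a `&` c) `&` b]meetAC ab meet0x !join0x meetA ?join0x.
Qed.

Lemma biimp_meet (a c : X) (s := (a =h> (a `&` c)) `&` (c =h> (c `&` a))) :
  s `&` a = s `&` c.
Proof.
have sac : s `&` a <= c by rewrite -le_shimpN leIl.
have sca : s `&` c <= a by rewrite -le_shimpN leIr.
by apply: le_anti; apply/andP; split; rewrite lexI leIl.
Qed.

Lemma N_axioms : semiNelson_axioms Nmeet Njoin Nimp Nneg Ntop.
Proof.
split.
- by move=> [[a b] Nab] [[c e] Nce]; apply: val_inj; congr pair;
    rewrite /= ?joinKI ?meetKU.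
- move=> [[a b] Nab] [[c e] Nce] [[f g] Nfg]; apply: val_inj.
  congr pair; rewrite /= ?(joinC (f `&` a)) ?(meetC (g `|` b)).
    by rewrite ![_ `&` a]meetC sh_meetUr.
  by rewrite ![_ `|` b]joinC sh_joinIr.
- by move=> [[a b] Nab]; apply: val_inj.
- by move=> [[a b] Nab] [[c e] Nce]; apply: val_inj.
- move=> [[a b] Nab] [[c e] Nce]; apply: val_inj.
  have [/= ab _] := in_NP _ Nab; have [/= ce _] := in_NP _ Nce.
  by congr pair; rewrite /= ?ab ?meet0x // [e `&` c]meetC ce joinx0.
- move=> [[a b] Nab] [[c e] Nce]; apply: val_inj.
  have [/= ab _] := in_NP _ Nab.
  congr pair; rewrite /= !sh_meetUr ab join0x ?join0x //.
  by rewrite meet_shimp meetA meetxx.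
- by move=> u v w; rewrite Nimp_curry.
- move=> u v w; rewrite !Nimp_curry; apply: Nimp_eq1 => /=.
  by rewrite (shimp_congl _ (biimp_meet _ _)) leIr.
- move=> u v w; rewrite !Nimp_curry; apply: Nimp_eq1 => /=.
  by rewrite (shimp_cong _ (biimp_meet _ _)) leIr.
- by move=> u v; apply: Nimp_eq1.
- by move=> u v; apply: Nimp_eq1.
Qed.

HB.instance Definition _ := isSemiNelson.Build N N_axioms.
End N.

Section Alpha.
Variables (X Y : sHF_obj) (f : sHF_hom X Y).

Lemma alpha_in_N (u : N X) : in_N (f (Nval u).1, f (Nval u).2).
Proof.
case: u => [[a b] /in_NP[/= ab Fab]].
have [fI fU _ f0 _] := sHF_homP f.
apply/in_NP; split => /=; first by rewrite -fI ab.
by rewrite -fU; apply: (sHF_sub (s := f)); exists (a `|` b).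
Qed.

Definition alpha_fun (u : N X) : N Y := NPair (alpha_in_N u).

Lemma alpha_hom : semiNelson_hom alpha_fun.
Proof.
have [fI fU fi f0 f1] := sHF_homP f.
by split=> *; apply: val_inj => /=;
  congr pair; rewrite /= ?(fI, fU, fi, f0, f1).
Qed.
End Alpha.

Definition alpha : functor sHF sN.
Proof.
apply: (@Functor sHF sN (fun X : sHF_obj => (N X : semiNelsonType))
  (fun X Y f => SNHom (@alpha_hom X Y f))).
- by move=> X; apply: sN_hom_eq => u; apply: val_inj; case: u => [[]].
- by move=> X Y Z g f; apply: sN_hom_eq => u; apply: val_inj.
Defined.

Section SemiNelsonTheory.
Variable A : semiNelsonType.
Implicit Types (x y z t : A).

Let SN1 := SN1_ (@snP A).
Let SN2 := SN2_ (@snP A).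
Let SN3 := SN3_ (@snP A).
Let SN4 := SN4_ (@snP A).
Let SN5 := SN5_ (@snP A).
Let SN6 := SN6_ (@snP A).
Let SN7 := SN7_ (@snP A).
Let SN8 := SN8_ (@snP A).
Let SN9 := SN9_ (@snP A).
Let SN10 := SN10_ (@snP A).

Lemma snnegK x : ~s ~s x = x. Proof. exact: SN3. Qed.

Lemma snnegI x y : ~s (x /s\ y) = ~s x \s/ ~s y. Proof. exact: SN4. Qed.

Lemma snnegU x y : ~s (x \s/ y) = ~s x /s\ ~s y.
Proof. by rewrite -[LHS]snnegK -[in RHS](snnegK (_ /s\ _)) snnegI !snnegK. Qed.

(* The first two axioms are those of Sholander for distributive lattices. *)
Lemma snmeetxx x : x /s\ x = x.
Proof.
have e : (x /s\ x) \s/ (x /s\ x) = x by rewrite -SN2 SN1.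
have e2 : (x /s\ x) /s\ x = x /s\ x by rewrite -[X in _ /s\ X]e SN1.
by rewrite -[X in _ /s\ X]e SN2 e2.
Qed.

Lemma snjoinxx x : x \s/ x = x.
Proof. by rewrite -[LHS]snnegK snnegU snmeetxx snnegK. Qed.

Lemma snmeetC x y : x /s\ y = y /s\ x.
Proof. by rewrite -{1}(snjoinxx y) SN2 snjoinxx. Qed.

Lemma snjoinC x y : x \s/ y = y \s/ x.
Proof. by rewrite -[LHS]snnegK snnegU snmeetC -snnegU snnegK. Qed.

Lemma snmeetUr x y z : x /s\ (y \s/ z) = (x /s\ y) \s/ (x /s\ z).
Proof. by rewrite SN2 snjoinC ![_ /s\ x]snmeetC. Qed.

Lemma snmeetUl x y z : (x \s/ y) /s\ z = (x /s\ z) \s/ (y /s\ z).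
Proof. by rewrite snmeetC snmeetUr ![_ /s\ z]snmeetC. Qed.

Lemma snjoinIr x y z : x \s/ (y /s\ z) = (x \s/ y) /s\ (x \s/ z).
Proof. by rewrite -[LHS]snnegK snnegU [~s (y /s\ z)]snnegI snmeetUr snnegU !snnegI !snnegK. Qed.

Lemma snjoinK x y : x /s\ (x \s/ y) = x. Proof. exact: SN1. Qed.

Lemma snmeetK x y : x \s/ (x /s\ y) = x.
Proof. by rewrite -[LHS]snnegK snnegU [~s (x /s\ y)]snnegI snjoinK snnegK. Qed.

Lemma snmeetA x y z : x /s\ (y /s\ z) = (x /s\ y) /s\ z.
Proof.
have abs (w v u : A) : w \s/ ((w /s\ v) /s\ u) = w.
  by rewrite snjoinIr snmeetK snjoinK.
set L := LHS; set R := RHS.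
have [xL yL zL] : [/\ x \s/ L = x, y \s/ L = y & z \s/ L = z].
  split; rewrite /L ?snmeetK // [x /s\ _]snmeetC ?abs //.
  by rewrite [y /s\ z]snmeetC abs.
have [xR yR zR] : [/\ x \s/ R = x, y \s/ R = y & z \s/ R = z].
  split; rewrite /R ?abs //; first by rewrite [x /s\ _]snmeetC abs.
  by rewrite [_ /s\ z]snmeetC snmeetK.
have e1 : L \s/ R = R.
  by rewrite {1}/R snjoinIr [L \s/ z]snjoinC zL snjoinIr ![L \s/ _]snjoinC xL yL.
have e2 : R \s/ L = L.
  by rewrite {1}/L snjoinIr [R \s/ x]snjoinC xR snjoinIr ![R \s/ _]snjoinC yR zR.
by rewrite -e2 snjoinC e1.
Qed.

Lemma snjoinA x y z : x \s/ (y \s/ z) = (x \s/ y) \s/ z.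
Proof. by rewrite -[LHS]snnegK !snnegU snmeetA -!snnegU snnegK. Qed.
End SemiNelsonTheory.

(* The lattice reduct of a semi-Nelson algebra, as a MathComp lattice. *)
Definition snlattice (A : semiNelsonType) : Type := A.

Section SemiNelsonLattice.
Variable A : semiNelsonType.

Lemma snmeetKU (y x : A) : x \s/ (x /s\ y) = x. Proof. exact: snmeetK. Qed.
Lemma snjoinKI (y x : A) : x /s\ (x \s/ y) = x. Proof. exact: snjoinK. Qed.

HB.instance Definition _ := SemiNelson.on (snlattice A).
HB.instance Definition _ := @Order.isMeetJoinDistrLattice.Build
  (Order.Disp tt tt) (snlattice A)
  (fun x y : A => x /s\ y == x) (fun x y : A => (y != x) && (x /s\ y == x))
  (@snmeet A) (@snjoin A) (fun _ _ => erefl) (fun _ _ => erefl)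
  (@snmeetC A) (@snjoinC A) (@snmeetA A) (@snjoinA A) snjoinKI snmeetKU
  (@snmeetUl A) (@snmeetxx A).
End SemiNelsonLattice.

Section SemiNelsonOrder.
Variable A : semiNelsonType.
Notation L := (snlattice A).
Implicit Types (x y z t u : L).

(* The operations of [A] on [L], and the axioms in the notations of orders. *)
Definition lneg x : L := ~s x.
Definition limp x y : L := x -s> y.
Definition lone : L := 1.
Definition lN x y : L := limp x (x `&` y).

Lemma lnegK x : lneg (lneg x) = x. Proof. exact: (SN3_ snP). Qed.
Lemma lnegI x y : lneg (x `&` y) = lneg x `|` lneg y.
Proof. exact: (SN4_ snP). Qed.
Lemma lnegU x y : lneg (x `|` y) = lneg x `&` lneg y.
Proof. exact: snnegU. Qed.
Lemma lkleene x y : x `&` lneg x <= y `|` lneg y.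
Proof. by rewrite leEmeet; apply/eqP/esym/(SN5_ snP). Qed.
Lemma lSN6 x y : x `&` lN x y = x `&` (lneg x `|` y).
Proof. exact: (SN6_ snP). Qed.
Lemma lNcurry x y z : lN x (lN y z) = lN (x `&` y) z.
Proof. exact: (SN7_ snP). Qed.
Lemma lSN8 x y z :
  lN (lN x y) (lN (lN y x) (lN (limp x z) (limp y z))) = lone.
Proof. exact: (SN8_ snP). Qed.
Lemma lSN9 x y z :
  lN (lN x y) (lN (lN y x) (lN (limp z x) (limp z y))) = lone.
Proof. exact: (SN9_ snP). Qed.
Lemma lSN10 x y : lN (lneg (limp x y)) (x `&` lneg y) = lone.
Proof. exact: (SN10_ snP). Qed.

Lemma lNI x y : lN x (x `&` y) = lN x y.
Proof. by rewrite /lN meetA meetxx. Qed.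

Lemma lneg_le x y : x <= y -> lneg y <= lneg x.
Proof. by move=> /join_idPl <-; rewrite lnegU leIr. Qed.

Lemma lNxx_aux x y (e := lN x x `&` limp x y) : lN e e = lone.
Proof.
have := lSN8 x x y; rewrite !lNcurry meetxx -/e => <-.
by rewrite -[RHS]lNI /e -[in X in _ = lN _ X]meetA meetxx.
Qed.

Lemma le_lNxx x : x <= lN x x.
Proof. by rewrite leEmeet lSN6 joinC joinKI. Qed.

Lemma lex_lone x : x <= lone.
Proof.
apply: le_trans (le_lNxx x) _.
have := lNxx_aux x x.
have -> : limp x x = lN x x by rewrite /lN meetxx.
by rewrite meetxx => <-; apply: le_lNxx.
Qed.

Lemma le_lneg1 x : lneg lone <= x.
Proof. by rewrite -[x]lnegK; apply: lneg_le; apply: lex_lone. Qed.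

HB.instance Definition _ := Order.hasBottom.Build _ L le_lneg1.
HB.instance Definition _ := Order.hasTop.Build _ L lex_lone.

Lemma lneg1 : lneg \top = \bot :> L. Proof. by []. Qed.
Lemma lneg0 : lneg \bot = \top :> L. Proof. exact: lnegK. Qed.

Lemma l1N y : lN \top y = y.
Proof. by have := lSN6 \top y; rewrite !meet1x lneg1 join0x. Qed.

Lemma lNxx x : lN x x = \top.
Proof.
have := lNxx_aux \top x; rewrite l1N meet1x.
by have := l1N x; rewrite {1}/lN meet1x => ->.
Qed.

Lemma limpxx x : limp x x = \top.
Proof. by have := lNxx x; rewrite /lN meetxx. Qed.

(* [lpre x y] iff the class of [x] is below the class of [y] in sH(A). *)
Definition lpre x y := lN x y == \top.

Lemma lpreE x y : lpre x y = (x <= lneg x `|` y).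
Proof.
apply/eqP/idP => [xy|xy].
  by rewrite leEmeet -lSN6 xy meetx1.
have -> : lN x y = lN x (lneg x `|` y).
  by rewrite -[RHS]lNI -lSN6 lNI lNcurry meetxx.
by rewrite -lNI (meet_l xy) lNxx.
Qed.

Lemma cut x y z : x <= y `|` z -> x `&` z <= y -> x <= y.
Proof.
move=> /meet_l xyz xzy; rewrite -xyz meetUr leUx leIr /=.
by apply: le_trans xzy.
Qed.

Lemma lpre_le x y : x <= y -> lpre x y.
Proof. by move=> xy; rewrite lpreE lexUr. Qed.

Lemma lpre_refl x : lpre x x. Proof. exact: lpre_le. Qed.

Lemma lpre_dual x y : lpre x y -> x `&` lneg y <= lneg x.
Proof.
rewrite lpreE => /lneg_le; rewrite lnegU lnegK //.
Qed.

Lemma lpre_trans y x z : lpre x y -> lpre y z -> lpre x z.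
Proof.
move=> xy; have := xy; rewrite !lpreE => xy' yz'.
apply: (@cut _ _ y); first by apply: le_trans xy' _; rewrite leU2 ?leUl.
apply: (@cut _ _ (lneg y)).
  by apply: le_trans (leIr _ _) _; rewrite joinC; apply: le_trans yz' _; rewrite leU2 ?leUr.
by rewrite meetAC leIxl // lexUl // lpre_dual.
Qed.

Lemma lpre_adj z x y : lpre z (lN x y) = lpre (z `&` x) y.
Proof. by rewrite /lpre lNcurry. Qed.

Lemma lpreI x y z : lpre x (y `&` z) = lpre x y && lpre x z.
Proof. by rewrite !lpreE joinIr lexI. Qed.

Lemma lpreIl x y z : lpre x z -> lpre (x `&` y) z.
Proof. by apply: lpre_trans; apply: lpre_le; rewrite leIl. Qed.

Lemma lpreIr x y z : lpre y z -> lpre (x `&` y) z.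
Proof. by apply: lpre_trans; apply: lpre_le; rewrite leIr. Qed.

Lemma lpreU x y z : lpre (x `|` y) z = lpre x z && lpre y z.
Proof.
have half t s : lpre t z -> lpre s z -> t <= lneg s `|` z.
  rewrite !lpreE => tz sz; apply: (@cut _ _ (lneg t)).
    by apply: le_trans tz _; rewrite joinC leU2 ?leUr.
  apply: le_trans (lkleene t s) _.
  by rewrite leUx sz leUl.
apply/idP/andP => [xyz|[xz yz]].
  by split; apply: lpre_trans xyz; apply: lpre_le; rewrite ?leUl ?leUr.
by rewrite lpreE lnegU joinIl lexI !leUx !half.
Qed.

Lemma lpre_meet x y z t : lpre x y -> lpre z t -> lpre (x `&` z) (y `&` t).
Proof. by move=> *; rewrite lpreI lpreIl ?lpreIr. Qed.

Lemma lpre_join x y z t : lpre x y -> lpre z t -> lpre (x `|` z) (y `|` t).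
Proof.
move=> xy zt; rewrite lpreU; apply/andP.
by split; [apply: lpre_trans xy _|apply: lpre_trans zt _];
  apply: lpre_le; rewrite ?leUl ?leUr.
Qed.

Lemma lpre_neg x y : lpre (x `&` lneg x) y.
Proof. by rewrite lpreE lnegI lnegK lexUl // lexUr // leIl. Qed.

Lemma lpre_impl t x y z : lpre (t `&` x) y -> lpre (t `&` y) x ->
  lpre (t `&` limp x z) (limp y z).
Proof.
move=> txy tyx; have /eqP := lSN8 x y z; rewrite !lNcurry; apply: lpre_trans.
by rewrite !lpreI !lpre_adj meetAC lpreIl // meetAC lpreIl // lpreIr ?lpre_refl.
Qed.

Lemma lpre_impr t x y z : lpre (t `&` x) y -> lpre (t `&` y) x ->
  lpre (t `&` limp z x) (limp z y).
Proof.
move=> txy tyx; have /eqP := lSN9 x y z; rewrite !lNcurry; apply: lpre_trans.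
by rewrite !lpreI !lpre_adj meetAC lpreIl // meetAC lpreIl // lpreIr ?lpre_refl.
Qed.

Lemma lpre_imp_rel t x y z u :
  lpre (t `&` x) y -> lpre (t `&` y) x ->
  lpre (t `&` z) u -> lpre (t `&` u) z ->
  lpre (t `&` limp x z) (limp y u).
Proof.
move=> xy yx zu uz; apply: (@lpre_trans (t `&` limp y z)).
  by rewrite lpreI lpre_le ?leIl //=; apply: lpre_impl.
exact: lpre_impr.
Qed.

Lemma lpre_mp x y : lpre (x `&` limp x y) y.
Proof.
rewrite meetC.
have : lpre (x `&` limp x y) (lN x y).
  by apply: lpre_impr; rewrite lpre_le // meetA leIr.
by rewrite lpre_adj meetAC meetxx meetC.
Qed.

Lemma lpre_imp_mp x y : lpre (x `&` y) (limp x y).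
Proof.
apply: (@lpre_trans (x `&` lN x y)).
  by rewrite lpreI lpre_le ?leIl //= lpre_adj lpre_le // -meetA leIxr // leIl.
by apply: lpre_impr; rewrite lpre_le // meetA leIr.
Qed.

Lemma lpre1 x : lpre \top x -> x = \top.
Proof. by move=> /eqP; rewrite l1N. Qed.

Lemma limp_eq1 x y :
  (limp x y == \top) && (limp y x == \top) = lpre x y && lpre y x.
Proof.
have imp1 t s : limp t s = \top -> lpre t s.
  by move=> ts; have := lpre_mp t s; rewrite ts meetx1.
apply/andP/andP => [[/eqP/imp1 xy /eqP/imp1 yx] //|[xy yx]].
have eq1 t s : lpre t s -> lpre s t -> limp t s = \top.
  move=> ts st; apply: lpre1.
  have := @lpre_impr \top t s t; rewrite !meet1x limpxx; exact.
by rewrite !eq1.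
Qed.
End SemiNelsonOrder.

Section sH.
Variable A : semiNelsonType.
Notation L := (snlattice A).
Implicit Types (x y z t : A).

Definition sneq x y := (x -s> y == 1) && (y -s> x == 1).

Lemma sneqE x y : sneq x y = @lpre A x y && @lpre A y x.
Proof. exact: limp_eq1. Qed.

Lemma sneq_refl : reflexive sneq.
Proof. by move=> x; rewrite sneqE lpre_refl. Qed.

Lemma sneq_sym : symmetric sneq.
Proof. by move=> x y; rewrite !sneqE andbC. Qed.

Lemma sneq_trans : transitive sneq.
Proof.
move=> y x z; rewrite !sneqE => /andP[xy yx] /andP[yz zy].
by rewrite (lpre_trans xy yz) (lpre_trans zy yx).
Qed.

Canonical sneq_equiv := EquivRel sneq sneq_refl sneq_sym sneq_trans.

Definition sH := {eq_quot sneq_equiv}.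
HB.instance Definition _ := Choice.on sH.
HB.instance Definition _ := EqQuotient.on sH.

Definition sHmeet := lift_op2 sH (@snmeet A).
Definition sHjoin := lift_op2 sH (@snjoin A).
Definition sHimp := lift_op2 sH (@snimp A).
Definition sHbot : sH := \pi_sH (~s 1).
Definition sHtop : sH := \pi_sH 1.

Lemma piP x y : reflect (\pi_sH x = \pi_sH y) (@lpre A x y && @lpre A y x).
Proof. by rewrite -sneqE; apply: eqmodP. Qed.

Lemma repr_pre x : @lpre A x (repr (\pi_sH x)) && @lpre A (repr (\pi_sH x)) x.
Proof. by apply/piP; rewrite reprK. Qed.

Lemma sHmeetE x y : sHmeet (\pi_sH x) (\pi_sH y) = \pi_sH (x /s\ y).
Proof.
rewrite /sHmeet -lock.
have /andP[x1 x2] := repr_pre x; have /andP[y1 y2] := repr_pre y.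
by apply/piP; rewrite (lpre_meet x1 y1) (lpre_meet x2 y2).
Qed.

Lemma sHjoinE x y : sHjoin (\pi_sH x) (\pi_sH y) = \pi_sH (x \s/ y).
Proof.
rewrite /sHjoin -lock.
have /andP[x1 x2] := repr_pre x; have /andP[y1 y2] := repr_pre y.
by apply/piP; rewrite (lpre_join x1 y1) (lpre_join x2 y2).
Qed.

Lemma limp_compat (x y z t : L) : lpre x z -> lpre z x -> lpre y t -> lpre t y ->
  lpre (limp x y) (limp z t).
Proof.
move=> xz zx yt ty; apply: (@lpre_trans _ (limp z y)).
  by have := @lpre_impl _ \top x z y; rewrite !meet1x; apply.
by have := @lpre_impr _ \top y t z; rewrite !meet1x; apply.
Qed.

Lemma sHimpE x y : sHimp (\pi_sH x) (\pi_sH y) = \pi_sH (x -s> y).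
Proof.
rewrite /sHimp -lock.
have /andP[x1 x2] := repr_pre x; have /andP[y1 y2] := repr_pre y.
by apply/piP; rewrite !limp_compat.
Qed.

Definition sHle (X Y : sH) := sHmeet X Y == X.

Lemma sHleE x y : sHle (\pi_sH x) (\pi_sH y) = @lpre A x y.
Proof.
rewrite /sHle sHmeetE; apply/eqP/idP => [/piP/andP[_]|xy].
  by rewrite lpreI => /andP[].
by apply/piP; rewrite lpreI lpre_refl xy andbT lpre_le // leIl.
Qed.

Fact sHmeetC : commutative sHmeet.
Proof. by elim/quotW=> x; elim/quotW=> y; rewrite !sHmeetE snmeetC. Qed.
Fact sHjoinC : commutative sHjoin.
Proof. by elim/quotW=> x; elim/quotW=> y; rewrite !sHjoinE snjoinC. Qed.
Fact sHmeetA : associative sHmeet.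
Proof.
by elim/quotW=> x; elim/quotW=> y; elim/quotW=> z; rewrite !sHmeetE snmeetA.
Qed.
Fact sHjoinA : associative sHjoin.
Proof.
by elim/quotW=> x; elim/quotW=> y; elim/quotW=> z; rewrite !sHjoinE snjoinA.
Qed.
Fact sHjoinKI (Y X : sH) : sHmeet X (sHjoin X Y) = X.
Proof. by elim/quotW: X => x; elim/quotW: Y => y; rewrite sHjoinE sHmeetE snjoinK. Qed.
Fact sHmeetKU (Y X : sH) : sHjoin X (sHmeet X Y) = X.
Proof. by elim/quotW: X => x; elim/quotW: Y => y; rewrite sHmeetE sHjoinE snmeetK. Qed.
Fact sHmeetUl : left_distributive sHmeet sHjoin.
Proof.
elim/quotW=> x; elim/quotW=> y; elim/quotW=> z.
by rewrite sHjoinE !sHmeetE sHjoinE snmeetUl.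
Qed.
Fact sHmeetxx : idempotent_op sHmeet.
Proof. by elim/quotW=> x; rewrite sHmeetE snmeetxx. Qed.

HB.instance Definition _ := @Order.isMeetJoinDistrLattice.Build
  (Order.Disp tt tt) sH sHle (fun X Y => (Y != X) && sHle X Y) sHmeet sHjoin
  (fun _ _ => erefl) (fun _ _ => erefl)
  sHmeetC sHjoinC sHmeetA sHjoinA sHjoinKI sHmeetKU sHmeetUl sHmeetxx.

Fact sH_le0x (X : sH) : sHbot <= X.
Proof. elim/quotW: X => x; apply: (etrans (sHleE _ _)).
by apply: lpre_le; apply: (@le0x _ (snlattice A)). Qed.
Fact sH_lex1 (X : sH) : X <= sHtop.
Proof. elim/quotW: X => x; apply: (etrans (sHleE _ _)).
by apply: lpre_le; apply: (@lex1 _ (snlattice A)). Qed.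

HB.instance Definition _ := Order.hasBottom.Build _ sH sH_le0x.
HB.instance Definition _ := Order.hasTop.Build _ sH sH_lex1.

Fact sH_meet_imp (X Y : sH) : X `&` sHimp X Y = X `&` Y.
Proof.
elim/quotW: X => x; elim/quotW: Y => y.
rewrite [RHS]sHmeetE sHimpE [LHS]sHmeetE; apply/piP.
by rewrite !lpreI lpre_mp lpre_imp_mp !lpreIl ?lpre_refl.
Qed.

Fact sH_meet_imp_meet (X Y Z : sH) :
  X `&` sHimp Y Z = X `&` sHimp (X `&` Y) (X `&` Z).
Proof.
elim/quotW: X => x; elim/quotW: Y => y; elim/quotW: Z => z.
have mE a b : (\pi_sH a `&` \pi_sH b) = \pi_sH (a /s\ b) by exact: sHmeetE.
rewrite !(mE, sHimpE); apply/piP; apply/andP.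
split; rewrite lpreI lpre_le ?leIl //=; apply: lpre_imp_rel;
  by rewrite lpre_le // meetA ?meetxx // leIr.
Qed.

Fact sH_impxx (X : sH) : sHimp X X = \top.
Proof.
elim/quotW: X => x; rewrite sHimpE; congr \pi_sH; exact: limpxx.
Qed.

HB.instance Definition _ := isSemiHeyting.Build _ sH
  sH_meet_imp sH_meet_imp_meet sH_impxx.
End sH.

Section Positive.
Variable A : semiNelsonType.
Notation L := (snlattice A).
Implicit Types (x y z t : L).

Lemma positiveP x : positive x <-> lneg x <= x.
Proof. by rewrite leEmeet; split=> [e|/eqP]; [apply/eqP|]. Qed.

Lemma positive_top : positive (\top : L).
Proof. by apply/positiveP; rewrite lex1. Qed.

Lemma positive_up x y : positive x -> x <= y -> positive y.
Proof.
move=> /positiveP xx xy; apply/positiveP.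
by apply: le_trans (lneg_le xy) (le_trans xx xy).
Qed.

Lemma positiveI x y : positive x -> positive y -> positive (x `&` y : L).
Proof.
have half z t : lneg z <= z -> lneg t <= t -> lneg z <= t.
  move=> /meet_l zz /join_idPl tt.
  by have := lkleene z t; rewrite meetC zz tt.
move=> /positiveP xx /positiveP yy; apply/positiveP.
rewrite lnegI lexI !leUx xx yy (half _ _ xx yy).
by rewrite (half _ _ yy xx).
Qed.

Definition sH_positive : set (sH A) :=
  [set \pi_(sH A) a | a in @positive A]%classic.

Lemma sH_positive_filter : lattice_filter sH_positive.
Proof.
split.
- by exists (\top : L) => //; exact: positive_top.
- move=> _ Y [x px <-]; elim/quotW: Y => y.
  move=> /(etrans (esym (sHleE _ _))) xy.
  exists ((x : L) `|` y); first by apply: positive_up px _; rewrite leUl.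
  by apply/piP; rewrite lpreU xy lpre_refl lpre_le // leUr.
- move=> _ _ [x px <-] [y py <-]; exists ((x : L) `&` y).
    exact: positiveI.
  by symmetry; exact: sHmeetE.
Qed.

Lemma sH_positive_dense : (dense_elements `<=` sH_positive)%classic.
Proof.
move=> X; elim/quotW: X => x; rewrite /dense_elements /= /shneg.
move=> /(etrans (esym (sHimpE _ _))) /piP /andP[x0 _].
exists ((x : L) `|` lneg x).
  by apply/positiveP; rewrite lnegU lnegK lexUl // leIr.
have nx0 : lpre (lneg (x : L)) \bot.
  have x0' : lpre (lN (x : L) \bot) \bot by rewrite /lN meetx0; exact: x0.
  apply: lpre_trans x0'.
  by rewrite lpre_adj meetC lpre_neg.
apply/piP; apply/andP; split; last by rewrite lpre_le ?leUl.
rewrite lpreU lpre_refl /=.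
by apply: lpre_trans nx0 _; rewrite lpre_le ?le0x.
Qed.

Lemma sH_positive_IF3 (Z T : sH A) : sH_positive (Z `|` T) ->
  forall X, sH_positive ((X =h> Z) `|` (X `&` T)).
Proof.
elim/quotW: Z => z; elim/quotW: T => t [c /positiveP cc].
move=> /(fun e => etrans e (sHjoinE _ _)) /piP /andP[czt _] X.
elim/quotW: X => x; pose z' : L := (z : L) `|` lneg c.
have zz' : lpre z z' by rewrite lpre_le ?leUl.
have z'z : lpre z' z.
  rewrite lpreU lpre_refl /= lpreE lnegK lexUl //.
pose e : L := limp x z' `|` ((x : L) `&` t).
exists e; last first.
  have -> : \pi_(sH A) x =h> \pi_(sH A) z = \pi_(sH A) (limp x z).
    exact: sHimpE.
  have -> : \pi_(sH A) x `&` \pi_(sH A) t = \pi_(sH A) ((x : L) `&` t).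
    exact: sHmeetE.
  apply: etrans (esym (sHjoinE _ _)); apply/piP.
  by rewrite !lpre_join ?limp_compat ?lpre_refl.
have e0 : lpre (lneg e) \bot.
  have h : lpre (lneg (limp x z')) ((x : L) `&` lneg z').
    exact/eqP/lSN10.
  rewrite /e lnegU; apply: (lpre_trans (lpre_meet h (lpre_refl _))).
  rewrite lnegI meetUr lpreU; apply/andP; split.
    by rewrite meetAC lpreIl // lpre_neg.
  apply: (@lpre_trans _ (((z : L) `|` t) `&` lneg ((z : L) `|` t))); last first.
    exact: lpre_neg.
  rewrite lpreI; apply/andP; split.
    apply: lpre_trans czt; rewrite lnegU lnegK lpre_le // meetA leIxl //.
    by rewrite leIr.
  by rewrite lpre_le // !lnegU leI2 // meetA leIxl // leIr.
apply/positiveP; have : lpre (lneg e) e by rewrite (lpre_trans e0) ?lpre_le ?le0x.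
by rewrite lpreE lnegK joinxx.
Qed.

Lemma sH_positive_ifilter : ifilter sH_positive.
Proof.
split; [exact: sH_positive_filter|exact: sH_positive_dense|].
exact: sH_positive_IF3.
Qed.
End Positive.

Section Beta.
Variables (A B : semiNelsonType) (f : sN_hom A B).

Definition beta_fun : sH A -> sH B := lift_op11 (sH A) (sH B) f.

Lemma beta_funE x : beta_fun (\pi_(sH A) x) = \pi_(sH B) (f x).
Proof.
rewrite /beta_fun -lock; have [_ _ fi _ f1] := sN_homP f.
have : sneq (repr (\pi_(sH A) x)) x.
  by rewrite sneqE andbC repr_pre.
by move=> /andP[/eqP e1 /eqP e2]; apply/eqmodP; rewrite /sneq_equiv /= /sneq -!fi e1 e2 f1 eqxx.
Qed.

Lemma beta_hom : semiHeyting_hom beta_fun.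
Proof.
have [fI fU fi fN f1] := sN_homP f.
split.
- elim/quotW=> x; elim/quotW=> y; rewrite !beta_funE.
  have -> : \pi_(sH A) x `&` \pi_(sH A) y = \pi_(sH A) (x /s\ y) by exact: sHmeetE.
  by rewrite beta_funE fI; symmetry; exact: sHmeetE.
- elim/quotW=> x; elim/quotW=> y; rewrite !beta_funE.
  have -> : \pi_(sH A) x `|` \pi_(sH A) y = \pi_(sH A) (x \s/ y) by exact: sHjoinE.
  by rewrite beta_funE fU; symmetry; exact: sHjoinE.
- elim/quotW=> x; elim/quotW=> y; rewrite !beta_funE.
  have -> : \pi_(sH A) x =h> \pi_(sH A) y = \pi_(sH A) (x -s> y) by exact: sHimpE.
  by rewrite beta_funE fi; symmetry; exact: sHimpE.
- by rewrite [LHS]beta_funE fN f1.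
- by rewrite [LHS]beta_funE f1.
Qed.

Lemma beta_sub :
  (beta_fun @` sH_positive (A := A) `<=` sH_positive (A := B))%classic.
Proof.
have [fI _ _ fN _] := sN_homP f.
move=> _ [_ [a pa <-] <-]; rewrite beta_funE; exists (f a) => //.
by rewrite /positive /= /snle -fN -fI pa.
Qed.
End Beta.

Definition beta_obj (A : semiNelsonType) : sHF_obj :=
  SHFObj (sH_positive_ifilter A).

Definition beta_map (A B : semiNelsonType) (f : sN_hom A B) :
  sHF_hom (beta_obj A) (beta_obj B) :=
  @SHFHom (beta_obj A) (beta_obj B) _ (beta_hom f) (@beta_sub A B f).

Definition beta : functor sN sHF.
Proof.
apply: (@Functor sN sHF beta_obj beta_map).
- by move=> A; apply: sHF_hom_eq; elim/quotW=> x; rewrite /= beta_funE.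
- move=> A B C g f; apply: sHF_hom_eq; elim/quotW=> x.
  by rewrite /= !beta_funE.
Defined.

(* Main.v *)
(** A class of sH(N(H,F)) is determined by the first components of its members,
    and every a in H occurs as one since a \/ a* is dense, hence in F; so
    [[(a,b)]] |-> a is an isomorphism from beta(alpha(H,F)) to (H,F).  In the
    other direction x |-> ([[x]],[[~x]]) embeds A into alpha(beta(A)) by the
    Kleene law, and it is onto because every (X,Y) with X /\ Y = 0 and
    X \/ Y = [[c]], c positive, Y = [[y]], is the image of (y -> ~1) /\ c. *)

From mathcomp Require Import all_boot all_order.
From mathcomp Require Import boolp classical_sets.
Require Import Defs.

Set Implicit Arguments.
Unset Strict Implicit.
Unset Printing Implicit Defensive.

Import Order.TTheory.
Local Open Scope order_scope.
Local Open Scope quotient_scope.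
Local Open Scope semiNelson_scope.

(** Lets the isomorphism on [sN] be built from the identity to [alpha beta]. Naturality of the
    chosen inverses is that of [eta], cancelled on both sides. *)
Lemma naturally_isomorphic_sym (C D : category) (F G : functor C D) :
  naturally_isomorphic F G -> naturally_isomorphic G F.
Proof.
move=> [eta eta_iso]; pose inv x := projT1 (cid (eta_iso x)).
have invK x : compc (inv x) (eta x) = idc _ by case: (projT2 (cid (eta_iso x))).
have etaK x : compc (eta x) (inv x) = idc _ by case: (projT2 (cid (eta_iso x))).
have nat_inv x y (f : hom x y) :
    compc (inv y) (fmap G f) = compc (fmap F f) (inv x).
  rewrite -[fmap G f]compc1 -etaK [compc (fmap G f) _]compcA -naturality.
  by rewrite !compcA invK comp1c.
by exists (NatTrans nat_inv) => x; exists (eta x).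
Qed.

(** A bijective homomorphism is not enough here: the inverse must map filter to filter, so [f] has
    to reflect membership. *)
Lemma sHF_is_iso (X Y : sHF) (f : hom X Y) :
  bijective (sHF_fun f) ->
  (forall x, sHF_filter Y (sHF_fun f x) -> sHF_filter X x) -> is_iso f.
Proof.
move=> [g fK gK] subF; have [fI fU fi f0 f1] := sHF_homP f.
have g_hom : semiHeyting_hom (g : sHF_alg Y -> sHF_alg X).
  by split=> *; apply: (can_inj fK); rewrite ?(fI, fU, fi, f0, f1) !gK.
have g_sub : (g @` sHF_filter Y `<=` sHF_filter X)%classic.
  by move=> _ [y Fy <-]; apply: subF; rewrite gK.
by exists (SHFHom g_hom g_sub); split; apply: sHF_hom_eq.
Qed.

Lemma sN_is_iso (A B : sN) (f : hom A B) : bijective (sN_fun f) -> is_iso f.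
Proof.
move=> [g fK gK]; have [fI fU fi fN f1] := sN_homP f.
have g_hom : semiNelson_hom (g : B -> A).
  by split=> *; apply: (can_inj fK); rewrite ?(fI, fU, fi, fN, f1) !gK.
by exists (SNHom g_hom); split; apply: sN_hom_eq.
Qed.

Section PseudoComplement.
Context {d : Order.disp_t} {H : semiHeytingType d}.
Implicit Types x y : H.

Lemma meet_shneg x : x `&` shneg x = \bot.
Proof. by rewrite meet_shimp meetx0. Qed.

Lemma le_shneg x y : (x <= shneg y) = (x `&` y == \bot).
Proof. by rewrite -lex0 -le_shimpN meetx0. Qed.

(** The pseudocomplement of [w = x \/ shneg x] is disjoint from [x], hence below [shneg x], hence
    below [w]; being disjoint from [w], it is 0. *)
Lemma dense_joinN x : dense_elements (x `|` shneg x).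
Proof.
apply/eqP; rewrite -lex0 -(meet_shneg (x `|` shneg x)) lexI lexx andbT.
by rewrite lexUr // le_shneg -lex0 -(meet_shneg (x `|` shneg x)) meetC leI2 ?leUl.
Qed.
End PseudoComplement.

Section CounitSHF.
Variable X : sHF_obj.

(** Makes the first projection both well defined and injective on classes. *)
Lemma lpre_NE (u v : N X) : @lpre (N X) u v = ((Nval u).1 <= (Nval v).1).
Proof.
apply/eqP/idP => [/(congr1 (fun w => (Nval w).1)) /= uv|].
  by rewrite -[(Nval u).1]meet1x -le_shimpN uv lexx.
exact: Nimp_eq1.
Qed.

Definition sHN_fst (c : sH (N X)) : X := (Nval (repr c)).1.

Lemma sHN_fstE (u : N X) : sHN_fst (\pi_(sH (N X)) u) = (Nval u).1.
Proof. by apply: le_anti; rewrite -!lpre_NE andbC; apply: repr_pre. Qed.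

Lemma sHN_fst_hom : semiHeyting_hom sHN_fst.
Proof.
split.
- elim/quotW=> u; elim/quotW=> v.
  by rewrite (sHmeetE u v : _ `&` _ = _) !sHN_fstE.
- elim/quotW=> u; elim/quotW=> v.
  by rewrite (sHjoinE u v : _ `|` _ = _) !sHN_fstE.
- elim/quotW=> u; elim/quotW=> v.
  by rewrite (sHimpE u v : _ =h> _ = _) !sHN_fstE.
- exact: sHN_fstE.
- exact: sHN_fstE.
Qed.

Lemma sHN_fst_sub :
  (sHN_fst @` sH_positive (A := N X) `<=` sHF_filter X)%classic.
Proof.
move=> _ [_ [u pu <-] <-]; rewrite sHN_fstE.
have [_ Fu] := in_NP _ (NvalP u).
(* For [u = (a,b)], the second components of [~u /\ u = ~u] give [a \/ b = a]. *)
by have := congr1 (fun w : N X => (Nval w).2) pu; rewrite /= => {1}<-.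
Qed.

Lemma sHN_fst_bij : bijective sHN_fst.
Proof.
have pairP a : in_N (a, shneg a : X).
  apply/in_NP; split; first exact: meet_shneg.
  by apply: (IF2 (sHF_ifilter X)); apply: dense_joinN.
exists (fun a => \pi_(sH (N X)) (NPair (pairP a))) => [|a]; last by rewrite sHN_fstE.
by elim/quotW=> u; rewrite sHN_fstE; apply/piP; rewrite !lpre_NE lexx.
Qed.

(** Replacing the second component by 0 keeps the class and makes the pair positive; membership of
    [a] in the filter is what allows the pair [(a,0)]. *)
Lemma sHN_fst_positive (c : sH (N X)) :
  sHF_filter X (sHN_fst c) -> sH_positive c.
Proof.
elim/quotW: c => u; rewrite sHN_fstE => Fu.
have Nu : in_N ((Nval u).1, \bot : X) by apply/in_NP; rewrite meetx0 joinx0.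
exists (NPair Nu); last by apply/piP; rewrite !lpre_NE lexx.
by apply: val_inj; rewrite /= /meet_pair /= meet0x joinx0.
Qed.

Definition counit_sHF : sHF_hom (beta_obj (N X)) X :=
  @SHFHom (beta_obj (N X)) X _ sHN_fst_hom sHN_fst_sub.

End CounitSHF.

Section UnitSN.
Variable A : semiNelsonType.
Notation L := (snlattice A).
Notation "[ x ]" := (\pi_(sH A) x).

Lemma sHN_meetN (x : A) : [x] `&` [~s x] = \bot.
Proof.
rewrite (sHmeetE x (~s x) : _ `&` _ = _); apply/piP.
by rewrite (@lpre_neg A x) lpre_le ?le0x.
Qed.

Lemma unit_in_N (x : A) : @in_N (beta_obj A) ([x], [~s x]).
Proof.
apply/in_NP; split; first exact: sHN_meetN.
(* This element is always positive: its negation [~x /\ x] lies below it. *)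
exists (x \s/ ~s x); last by symmetry; apply: sHjoinE.
apply/(@positiveP A (x \s/ ~s x)).
by rewrite [lneg _](@lnegU A x (~s x)) [lneg (~s x)]snnegK lexUl // leIr.
Qed.

Definition unit_fun (x : A) : N (beta_obj A) := NPair (unit_in_N x).

Lemma unit_hom : semiNelson_hom unit_fun.
Proof.
split=> [x y|x y|x y|x|]; apply: val_inj; congr pair.
- by symmetry; apply: sHmeetE.
- by rewrite [RHS](sHjoinE (~s x) (~s y)) snnegI.
- by symmetry; apply: sHjoinE.
- by rewrite [RHS](sHmeetE (~s x) (~s y)) snnegU.
- by symmetry; apply: sHimpE.
(* SN10 and SN11 are the two halves of [~(x -> y)] being equivalent to [x /\ ~y]. *)
- rewrite [RHS](sHmeetE x (~s y)); apply/piP.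
  by apply/andP; split; apply/eqP; [apply: (SN10_ snP) | apply: (SN11_ snP)].
- by rewrite /= snnegK.
Qed.

(** Two cuts: the first hypothesis reduces the goal to [x /\ ~x <= y]; the Kleene law
    [x /\ ~x <= y \/ ~y] then leaves only [x /\ ~y <= y], the dual of the second. *)
Lemma lpre_antisym (x y : L) : lpre x y -> lpre (lneg y) (lneg x) -> x <= y.
Proof.
move=> xy /lpre_dual; rewrite !lnegK => yx.
rewrite lpreE in xy; apply: (@cut _ _ _ (lneg x)); first by rewrite joinC.
apply: (@cut _ _ _ (lneg y)); first exact: lkleene.
by apply: le_trans yx; rewrite meetC leI2 ?leIl.
Qed.

Lemma unit_inj : injective unit_fun.
Proof.
move=> x y /(congr1 val)[/piP/andP[xy yx] /piP/andP[nxy nyx]].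
by apply: (@le_anti _ L); rewrite !lpre_antisym.
Qed.

(* In N(H,F), with c = (c1,0) and a \/ b = c1, the element ((b,_) -> 0) /\ c is
   (b* /\ (a \/ b), b) = (a,b). *)
Lemma unit_surj (u : N (beta_obj A)) : exists x, unit_fun x = u.
Proof.
case: u => [[a b] Nab]; have [/= ab [c pc /esym abc]] := in_NP _ Nab.
elim/quotW: b Nab ab abc => y Nab ay ayc.
exists ((y -s> ~s 1) /s\ c); apply: val_inj; congr pair.
  rewrite -[LHS]sHmeetE -sHimpE -ayc.
  change (shneg [y] `&` (a `|` [y]) = a).
  rewrite sh_meetUr [_ `&` [y]]meetC meet_shneg joinx0 meetC.
  by apply: meet_l; rewrite le_shneg ay.
rewrite /= snnegI -sHjoinE.
(* Positivity of [c] turns [~c /\ c] into [~c]. *)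
have -> : [~s c] = \bot.
  by rewrite -(sHN_meetN c) (sHmeetE c (~s c) : _ `&` _ = _) snmeetC pc.
rewrite [LHS]joinx0; apply/piP.
(* With [~1] as second argument, SN10 and SN11 make [~(y -> ~1)] equivalent to [y]. *)
have := @lSN10 A y (~s 1); have := SN11_ (@snP A) y (~s 1).
rewrite snnegK [y /s\ 1](@meetx1 _ L y).
rewrite [lneg (~s 1)]snnegK [(y : L) `&` _](@meetx1 _ L y) => /eqP e1 /eqP e2.
by apply/andP.
Qed.

Lemma unit_bij : bijective unit_fun.
Proof.
pose g u := projT1 (cid (unit_surj u)).
have gK : cancel g unit_fun by move=> u; apply: (projT2 (cid (unit_surj u))).
by exists g => // x; apply: unit_inj.
Qed.
End UnitSN.

Theorem theorem3p13 :
  naturally_isomorphic (functor_comp beta alpha) (functor_id sHF) /\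
  naturally_isomorphic (functor_comp alpha beta) (functor_id sN).
Proof.
split.
  have nat_counit (X Y : sHF) (f : hom X Y) :
      compc (counit_sHF Y : hom (functor_comp beta alpha Y) (functor_id sHF Y))
        (fmap (functor_comp beta alpha) f) =
      compc (fmap (functor_id sHF) f) (counit_sHF X).
    apply: sHF_hom_eq; elim/quotW=> u.
    by rewrite /= beta_funE !sHN_fstE.
  exists (NatTrans nat_counit) => X.
  by apply: sHF_is_iso; [apply: sHN_fst_bij | apply: sHN_fst_positive].
apply: naturally_isomorphic_sym.
have nat_unit (A B : sN) (f : hom A B) :
    compc (SNHom (unit_hom B) : hom (functor_id sN B) (functor_comp alpha beta B))
      (fmap (functor_id sN) f) =
    compc (fmap (functor_comp alpha beta) f) (SNHom (unit_hom A)).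
  apply: sN_hom_eq => x; apply: val_inj.
  by rewrite /= !beta_funE (sn_neg (sN_homP f)).
exists (NatTrans nat_unit) => A.
by apply: sN_is_iso; apply: unit_bij.
Qed.
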